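(* Let $a,b,c$ be $F$-continuous real functions on $F\cap[a_0,b_0]$, with neither $b$ nor $c$ identically zero, and consider the Riccati-type fractal differential equation $$D^{\alpha}_F y(t)=a(t)\,y(t)+b(t)\,y^2(t)+c(t),\qquad t\in F\cap[a_0,b_0].\qquad (R)$$ Let $u$ be a particular solution of $(R)$. Then each solution $y$ of $(R)$ has the form $$y(t)=u(t)+v(t),\qquad t\in F\cap[a_0,b_0],$$ where $v$ is a solution of the Bernoulli-type fractal differential equation $$D^{\alpha}_F v(t)=\bigl(a(t)+2b(t)u(t)\bigr)v(t)+b(t)\,v^2(t),\qquad t\in F\cap[a_0,b_0].$$
   Context: Setting: $\alpha\in(0,1]$; $F\subset\mathbb{R}$ is a compact $\alpha$-perfect set of fractal (Hausdorff) dimension $\alpha$; $[a_0,b_0]$ is an interval with $F\cap[a_0,b_0]\neq\emptyset$. Let $\mathcal{H}^\alpha$ be the $\alpha$-dimensional Hausdorff measure, $\mathcal{H}^\alpha(A)=\lim_{\delta\to0}\inf\{\sum_i(\mathrm{diam}A_i)^\alpha: A\subset\bigcup_i A_i,\ \mathrm{diam}A_i\le\delta\}$. Fix $p\in[a_0,b_0]$. The staircase function is $S^\alpha_F(t)=\Gamma(\alpha+1)\mathcal{H}^\alpha(F\cap[p,t])$ if $t\ge p$ and $S^\alpha_F(t)=-\Gamma(\alpha+1)\mathcal{H}^\alpha(F\cap[t,p])$ if $t<p$. That $F$ is $\alpha$-perfect means that $S^\alpha_F$ is finite and $F$ is exactly the set of points at which $S^\alpha_F$ is not locally constant, this set being closed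 and without isolated points. $F$-limit: $F\text{-}\lim_{y\to t} g(y)=\ell$ means the limit along $y\in F\cap[a_0,b_0]$, $y\ne t$: for every $\varepsilon>0$ there is $\delta>0$ with $|g(y)-\ell|<\varepsilon$ whenever $y\in F\cap[a_0,b_0]$, $0<|y-t|<\delta$. A function $f$ is $F$-continuous if $F\text{-}\lim_{y\to t}f(y)=f(t)$ for every $t\in F\cap[a_0,b_0]$. Fractal derivative: for $f:[a_0,b_0]\to\mathbb{R}$, $D^\alpha_Ff(t)=F\text{-}\lim_{y\to t}\frac{f(y)-f(t)}{S^\alpha_F(y)-S^\alpha_F(t)}$ if $t\in F\cap[a_0,b_0]$ (when this limit exists), and $D^\alpha_Ff(t)=0$ if $t\in[a_0,b_0]\setminus F$. $f$ is $F^\alpha$-derivable if it has a fractal derivative at every point. A solution of a fractal differential equation is an $F^\alpha$-derivable function satisfying the equation at every point of $F\cap[a_0,b_0]$. *)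

(* Defs.v *)
From mathcomp Require Import all_boot all_order all_algebra.
From mathcomp Require Import all_classical all_reals all_analysis.

Set Implicit Arguments.
Unset Strict Implicit.
Unset Printing Implicit Defensive.

Import Order.TTheory GRing.Theory Num.Theory.
Import numFieldNormedType.Exports.

Local Open Scope classical_set_scope.
Local Open Scope ring_scope.

(* Euler's integral, meaningful for s > 0. *)
Definition Gamma {R : realType} (s : R) : R :=
  \int[lebesgue_measure]_(x in `]0, +oo[) (x `^ (s - 1) * expR (- x)).

(* The maximum with 0 only matters for the empty set, since the library has
   ereal_sup set0 = -oo. *)
Definition diam {R : realType} (A : set R) : \bar R :=
  maxe 0%E (ereal_sup [set (`|x - y|)%:E | x in A & y in A]).

(* Covers are sequences; finite covers are padded with set0, whose diameter
   contributes 0 `^ s = 0 when s > 0.  The case s = 0 is never used: the library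
   has 0 `^ 0 = 1. *)
Definition hausdorff_content {R : realType} (s delta : R) (A : set R) : \bar R :=
  ereal_inf [set (\sum_(0 <= i <oo) (diam (B i)) `^ s)%E | B in
    [set B : nat -> set R | A `<=` \bigcup_i B i /\
                            forall i, (diam (B i) <= delta%:E)%E]].

Definition hausdorff_measure {R : realType} (s : R) (A : set R) : \bar R :=
  lim (hausdorff_content s delta A @[delta --> 0^'+]).

Definition hausdorff_dim {R : realType} (A : set R) : \bar R :=
  ereal_inf [set s%:E | s in [set s : R | 0 < s /\ hausdorff_measure s A = 0%E]].

Definition estaircase {R : realType} (alpha : R) (F : set R) (p t : R) : \bar R :=
  if p <= t
  then ((Gamma (alpha + 1))%:E * hausdorff_measure alpha (F `&` `[p, t]))%E
  else (- ((Gamma (alpha + 1))%:E * hausdorff_measure alpha (F `&` `[t, p])))%E.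

(* The real-valued staircase; faithful when estaircase is finite, which
   alpha_perfect requires. *)
Definition staircase {R : realType} (alpha : R) (F : set R) (p t : R) : R :=
  fine (estaircase alpha F p t).

Definition locally_constant_at {R : realType} (f : R -> R) (t : R) : Prop :=
  \forall y \near t, f y = f t.

Definition alpha_perfect {R : realType} (alpha : R) (F : set R) (p : R) : Prop :=
  [/\ forall t, estaircase alpha F p t \is a fin_num,
      F = [set t | ~ locally_constant_at (staircase alpha F p) t] &
      perfect_set F].

(* Functions on [a0, b0], or on F `&` [a0, b0], are total functions R -> R whose
   values elsewhere are never used. *)

(* F-lim_{y -> t} g(y) = l.  This is a relation: l is not unique if t is isolated
   in F `&` [a0, b0], which can happen at the endpoints a0 and b0. *)
Definition Flim {R : realType} (F : set R) (a0 b0 : R) (g : R -> R) (t l : R) :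
    Prop :=
  g y @[y --> within (F `&` `[a0, b0]) t^'] --> l.

Definition Fcontinuous {R : realType} (F : set R) (a0 b0 : R) (f : R -> R) :
    Prop :=
  forall t, (F `&` `[a0, b0]) t -> Flim F a0 b0 f t (f t).

(* For t in [a0, b0]: D^alpha_F f(t) exists and equals l. *)
Definition is_fractal_derive {R : realType} (alpha : R) (F : set R) (p a0 b0 : R)
    (f : R -> R) (t l : R) : Prop :=
  if t \in F
  then Flim F a0 b0
         (fun y => (f y - f t) / (staircase alpha F p y - staircase alpha F p t))
         t l
  else l = 0.

Definition fractal_derivable {R : realType} (alpha : R) (F : set R) (p a0 b0 : R)
    (f : R -> R) : Prop :=
  forall t, t \in `[a0, b0] -> exists l, is_fractal_derive alpha F p a0 b0 f t l.

(* y solves D^alpha_F y(t) = G(t, y(t)) on F `&` [a0, b0]. *)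
Definition fractal_solution {R : realType} (alpha : R) (F : set R) (p a0 b0 : R)
    (G : R -> R -> R) (y : R -> R) : Prop :=
  fractal_derivable alpha F p a0 b0 y /\
  forall t, (F `&` `[a0, b0]) t ->
    is_fractal_derive alpha F p a0 b0 y t (G t (y t)).

(* Main.v *)
Require Import Defs.
From mathcomp Require Import all_boot all_order all_algebra.
From mathcomp Require Import all_classical all_reals all_analysis.
From mathcomp Require Import ring.
Import Order.TTheory GRing.Theory Num.Theory.
Import numFieldNormedType.Exports.
Local Open Scope classical_set_scope.
Local Open Scope ring_scope.

(** The fractal derivative is a limit of difference quotients that are linear in
    the function, so it is additive at every point, on [F] and off it
    ([is_fractal_deriveB]).  Hence [v = y - u] is again derivable, and on [F] its
    derivative is the difference of the two right-hand sides of the Riccati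
    equation.  There the term [c] cancels, and
    [y ^+ 2 - u ^+ 2 = v ^+ 2 + 2 * u * v] turns what remains into the Bernoulli
    right-hand side at [v].  All of this is pointwise and concerns some
    derivative rather than the derivative, so it also covers endpoints that are
    isolated in [F `&` `[a0, b0]], where every number is a derivative. *)

Lemma is_fractal_deriveB {R : realType} {alpha : R} {F : set R} {p a0 b0 : R}
    {f g : R -> R} {t k l : R} :
  is_fractal_derive alpha F p a0 b0 f t k ->
  is_fractal_derive alpha F p a0 b0 g t l ->
  is_fractal_derive alpha F p a0 b0 (fun s => f s - g s) t (k - l).
Proof.
rewrite /is_fractal_derive; case: ifP => _; last by move=> -> ->; rewrite subrr.
rewrite /Flim => fk gl.
rewrite (_ : (fun y => _) = fun y =>
    (f y - f t) / (staircase alpha F p y - staircase alpha F p t) -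
    (g y - g t) / (staircase alpha F p y - staircase alpha F p t)).
  exact: cvgB fk gl.
by apply/funext => y; rewrite -mulrBl; congr (_ * _); ring.
Qed.

Lemma fractal_derivableB {R : realType} {alpha : R} {F : set R} {p a0 b0 : R}
    {f g : R -> R} :
  fractal_derivable alpha F p a0 b0 f -> fractal_derivable alpha F p a0 b0 g ->
  fractal_derivable alpha F p a0 b0 (fun s => f s - g s).
Proof.
move=> df dg t tab; have [k fk] := df t tab; have [l gl] := dg t tab.
by exists (k - l); exact: is_fractal_deriveB.
Qed.

Theorem proposition4p1 (R : realType) (alpha : R) (F : set R) (a0 b0 p : R)
    (a b c u : R -> R)
    (alpha_gt0 : 0 < alpha) (alpha_le1 : alpha <= 1)
    (p_in : p \in `[a0, b0])
    (F_compact : compact F)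
    (F_perfect : alpha_perfect alpha F p)
    (F_dim : hausdorff_dim F = alpha%:E)
    (F_meets : F `&` `[a0, b0] !=set0)
    (a_cont : Fcontinuous F a0 b0 a)
    (b_cont : Fcontinuous F a0 b0 b)
    (c_cont : Fcontinuous F a0 b0 c)
    (b_neq0 : exists2 t, (F `&` `[a0, b0]) t & b t != 0)
    (c_neq0 : exists2 t, (F `&` `[a0, b0]) t & c t != 0)
    (u_sol : fractal_solution alpha F p a0 b0
               (fun t z => a t * z + b t * z ^+ 2 + c t) u) :
  forall y : R -> R,
    fractal_solution alpha F p a0 b0
      (fun t z => a t * z + b t * z ^+ 2 + c t) y ->
    exists v : R -> R,
      fractal_solution alpha F p a0 b0
        (fun t z => (a t + 2 * b t * u t) * z + b t * z ^+ 2) v /\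
      forall t, (F `&` `[a0, b0]) t -> y t = u t + v t.
Proof.
move=> y [dy y_eq]; case: u_sol => du u_eq.
exists (fun t => y t - u t); split; last by move=> t _; rewrite addrC subrK.
split=> [|t tF]; first exact: fractal_derivableB.
have := is_fractal_deriveB (y_eq t tF) (u_eq t tF).
by congr is_fractal_derive; ring.
Qed.
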